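(* Let $\mathcal{Z}$ be a measurable space, $d:\mathcal{Z}\times\mathcal{Z}\to[0,\infty]$ a measurable function with $d(z,z)=0$ for all $z$, $\bm{l}:\mathcal{Z}\times\Theta\to\mathbb{R}$ a loss function, $\theta\in\Theta$, $\mathcal{Z}_N=\{Z^{(1)},\dots,Z^{(N)}\}\subset\mathcal{Z}$, $\mathbb{P}_N=\sum_{i=1}^N\mu_i\bm{\chi}_{\{Z^{(i)}\}}$ a probability measure ($\bm{\chi}_{\{z\}}$ is the Dirac mass at $z$), and $p\in[1,\infty]$. With the DR risk $\mathcal{R}_p$, empirical loss $\hat{\mathcal{R}}$, rates $\Delta_\theta,\Delta_\theta^{\max}$ and majorants $\mathcal{S}_f,\mathcal{C}_f$ defined in the context, for every $\epsilon>0$: (Lower bound) $$\mathcal{R}_p(\epsilon)-\hat{\mathcal{R}}\ \ge\ \operatorname{lb}_p(\epsilon):=\sum_{i=1}^N\mu_i\,s^{(i)}(\epsilon),$$ where $s^{(i)}(\epsilon)=\mathcal{S}_{f^{(i)}}(\epsilon^p)$ with $f^{(i)}(t)=\Delta_\theta(Z^{(i)},t^{1/p})$ if $p<\infty$, and $s^{(i)}(\epsilon)=\Delta_\theta(Z^{(i)},\epsilon)$ if $p=\infty$. (Upper bound) $$\mathcal{R}_p(\epsilon)-\hat{\mathcal{R}}\ \le\ \operatorname{cc}_p(\epsilon),$$ where $\operatorname{cc}_p(\epsilon):=\mathcal{C}_{f^{\max}}(\epsilon^p)$ with $f^{\max}(t)=\Delta_\theta^{\max}(t^{1/p})$ if $p<\infty$,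 and $\operatorname{cc}_\infty(\epsilon):=\sum_{i=1}^N\mu_i\lim_{t\to\epsilon^+}\Delta_\theta(Z^{(i)},t)$ if $p=\infty$.
   Context: Convention: $0\cdot\infty=0$. $\mathcal{P}(\mathcal{Z})$ is the set of probability measures on $\mathcal{Z}$; $\bm{l}(\cdot;\theta)$ is measurable. Wasserstein discrepancy: for $p\in[1,\infty)$, $\mathcal{W}_p(\mathbb{P},\mathbb{Q})=\big(\inf_{\pi\in\Pi(\mathbb{P},\mathbb{Q})}\int d^p(z',z)\,\mathrm{d}\pi(z',z)\big)^{1/p}$, and $\mathcal{W}_\infty(\mathbb{P},\mathbb{Q})=\inf_{\pi\in\Pi(\mathbb{P},\mathbb{Q})}\operatorname{ess.sup}_\pi(d)$, where $\Pi(\mathbb{P},\mathbb{Q})$ is the set of couplings with first marginal $\mathbb{P}$ and second marginal $\mathbb{Q}$. Distributionally robust (DR) risk: $\mathcal{R}_p(\epsilon)=\sup\{\mathbb{E}_{\mathbb{P}}[\bm{l}(Z;\theta)]:\mathbb{P}\in\mathcal{P}(\mathcal{Z}),\ \mathcal{W}_p(\mathbb{P},\mathbb{P}_N)\le\epsilon\}$ (over those $\mathbb{P}$ for which the expectation is well defined in $[-\infty,\infty]$). Empirical loss: $\hat{\mathcal{R}}=\mathbb{E}_{\mathbb{P}_N}[\bm{l}(Z;\theta)]$. Individual rate: $\Delta_\theta(z,t)=\sup_{z'\in\mathcal{Z}}\{\bm{l}(z';\theta)-\bm{l}(z;\theta): d(z',z)\le t\}\in[0,\infty]$ for $t\ge0$.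 Maximal rate: $\Delta_\theta^{\max}(t)=\max_{Z^{(i)}\in\mathcal{Z}_N}\Delta_\theta(Z^{(i)},t)$. Majorants: a function on $[0,\infty)$ is concave if its hypograph $\{(x,y)\in[0,\infty)\times\mathbb{R}: y\le f(x)\}$ is convex; a function $f$ with $f(0)\ge0$ is star-shaped if its hypograph $H$ satisfies $\eta h\in H$ for all $h\in H$, $\eta\in[0,1]$. For a nonnegative $f$ on $[0,\infty)$, the least concave majorant is $\mathcal{C}_f(t)=\inf\{H(t): H\ge f,\ H\text{ concave}\}$ and the least star-shaped majorant is $\mathcal{S}_f(t)=\inf\{H(t): H\ge f,\ H\text{ star-shaped}\}$; all functions here may take the value $+\infty$, and $\mathcal{C}_f,\mathcal{S}_f$ take values in $[0,\infty]$. *)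

(* Defs.v *)
From HB Require Import structures.
From mathcomp Require Import all_boot all_order all_algebra.
From mathcomp Require Import all_classical all_reals all_analysis.
From mathcomp Require Import measurable_realfun ess_sup_inf.
Set Implicit Arguments.
Unset Strict Implicit.
Unset Printing Implicit Defensive.
Import Order.TTheory GRing.Theory Num.Theory.
Import numFieldNormedType.Exports.
Local Open Scope classical_set_scope.
Local Open Scope ring_scope.
Local Open Scope ereal_scope.

(* The order p ranges over [1, +oo] as an element of \bar R; the values
   attached to p = -oo below are placeholders. *)

Section transport.
Context {R : realType} {disp : measure_display} {Z : measurableType disp}.
Implicit Types (P Q : probability Z R) (d : Z -> Z -> \bar R).

Definition coupling P Q : set (probability (Z * Z)%type R) :=
  [set pi | (forall A, measurable A -> pi (A `*` [set: Z]) = P A) /\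
            (forall B, measurable B -> pi ([set: Z] `*` B) = Q B)].

Definition wasserstein d (p : \bar R) P Q : \bar R :=
  match p with
  | r%:E => (ereal_inf [set \int[pi]_z (d z.1 z.2 `^ r) | pi in coupling P Q])
              `^ r^-1
  | +oo => ereal_inf
             [set ess_sup pi (fun z => d z.1 z.2) | pi in coupling P Q]
  | -oo => 0
  end.

(* Well-definedness in [-oo, +oo]; without it the library integral would read
   +oo - oo as -oo. *)
Definition expectation_defined P (X : Z -> R) : Prop :=
  \int[P]_z (EFin \o X)^\+ z < +oo \/ \int[P]_z (EFin \o X)^\- z < +oo.

Definition dr_risk d (p : \bar R) P0 (X : Z -> R) (eps : R) : \bar R :=
  ereal_sup ((fun P => 'E_P[X]) @`
    [set P | wasserstein d p P P0 <= eps%:E /\ expectation_defined P X]).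

End transport.

Section majorants.
Context {R : realType}.
Implicit Types f H : R -> \bar R.

(* Functions on [0, +oo) are represented by R -> \bar R; their values at
   negative arguments are never used. *)
Definition hypograph f : set (R^o * R^o)%type :=
  [set xy | (0 <= xy.1)%R /\ xy.2%:E <= f xy.1].

Definition concave f : Prop := convex_set (hypograph f).

Definition star_shaped f : Prop :=
  0 <= f 0%R /\
  forall (h : (R^o * R^o)%type) (eta : R), hypograph f h ->
    (0 <= eta <= 1)%R -> hypograph f (eta *: h)%R.

Definition majorizes H f : Prop := forall t : R, (0 <= t)%R -> f t <= H t.

Definition least_concave_majorant f (t : R) : \bar R :=
  ereal_inf [set H t | H in [set H | majorizes H f /\ concave H]].

Definition least_star_majorant f (t : R) : \bar R :=
  ereal_inf [set H t | H in [set H | majorizes H f /\ star_shaped H]].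

End majorants.

Section rates.
Context {R : realType} {disp : measure_display} {Z : measurableType disp}.
Variables (d : Z -> Z -> \bar R) (X : Z -> R).

(* X stands for the loss z |-> l(z; theta) at the fixed parameter theta. *)
Definition rate (z : Z) (t : R) : \bar R :=
  ereal_sup [set (X z' - X z)%:E | z' in [set z' | d z' z <= t%:E]].

Definition max_rate (N : nat) (zs : 'I_N -> Z) (t : R) : \bar R :=
  \big[maxe/-oo]_(i < N) rate (zs i) t.

Definition lower_term (p : \bar R) (z : Z) (eps : R) : \bar R :=
  match p with
  | r%:E => least_star_majorant (fun t => rate z (t `^ r^-1)%R) (eps `^ r)%R
  | +oo => rate z eps
  | -oo => 0
  end.

Definition lower_bound (p : \bar R) (N : nat) (mu : 'I_N -> R)
    (zs : 'I_N -> Z) (eps : R) : \bar R :=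
  \sum_(i < N) (mu i)%:E * lower_term p (zs i) eps.

Definition upper_bound (p : \bar R) (N : nat) (mu : 'I_N -> R)
    (zs : 'I_N -> Z) (eps : R) : \bar R :=
  match p with
  | r%:E => least_concave_majorant (fun t => max_rate zs (t `^ r^-1)%R)
              (eps `^ r)%R
  | +oo => \sum_(i < N) (mu i)%:E * lim (rate (zs i) t @[t --> eps^'+])
  | -oo => 0
  end.

End rates.

(* Main.v *)
Require Import Defs.
From mathcomp Require Import all_boot all_order all_algebra.
From mathcomp Require Import all_classical all_reals all_analysis.
From mathcomp Require Import measurable_realfun ess_sup_inf.
From mathcomp Require Import ring lra.
Import Order.TTheory GRing.Theory Num.Theory.
Import numFieldNormedType.Exports.
Local Open Scope classical_set_scope.
Local Open Scope ring_scope.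
Local Open Scope ereal_scope.

(* Lower bound: from each atom Z^(i) move a fraction eta_i of its mass to some
   z'_i with eta_i d(z'_i, Z^(i))^p <= eps^p.  The resulting measure is feasible
   and gains sum_i mu_i eta_i (l(z'_i) - l(Z^(i))); the supremum of these gains
   over (eta_i, z'_i) is star-shaped in eps^p and dominates the individual rate,
   hence also its least star-shaped majorant.
   Upper bound: E_P[l] - E_PN[l] is the integral of l(z') - l(z) against a nearly
   optimal coupling.  For p < oo, l(z') - l(z) <= H(d(z',z)^p) <=
   a + m d(z',z)^p for a supporting line of the concave majorant H at eps^p;
   for p = oo the integrand is bounded by the individual rate at a radius
   slightly larger than eps. *)

(** * Supporting lines of extended-valued concave functions *)

Lemma concave_hypograph_conv {R : realType} {H : R -> \bar R} {x y u v k : R} :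
  Defs.concave H -> (0 <= x)%R -> (0 <= y)%R -> u%:E <= H x -> v%:E <= H y ->
  (0 <= k <= 1)%R ->
  (k * u + (1 - k) * v)%:E <= H (k * x + (1 - k) * y)%R.
Proof.
move=> cH x0 y0 uH vH /andP[k0 k1].
have kE : Itv.spec (@Itv.num_sem R) (Itv.Real `[0, 1]%Z) k.
  by rewrite /= /Itv.num_sem/= in_itv/= k0 k1 realE k0.
have := cH (x, u) (y, v) (Itv.mk kE).
rewrite !inE => /(_ (conj x0 uH) (conj y0 vH))[_].
by rewrite /= /conv /=.
Qed.

Lemma le_of_EFin_le (R : realType) (x : \bar R) (b : R) :
  (forall v : R, v%:E <= x -> (v <= b)%R) -> x <= b%:E.
Proof.
case: x => [r|h|_]; last exact: leNye.
  by move=> h; rewrite lee_fin h.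
by have := h (b + 1)%R (leey _); rewrite gerDl leNgt ltr01.
Qed.

(** The slope is the supremum of the difference quotients of [H] to the right of [e]; concavity
    bounds it by every quotient to the left. Nonnegativity of [H] on the whole half-line gives the
    signs of [a] and [m]. *)
Lemma concave_supporting_line (R : realType) (H : R -> \bar R) (e : R) :
  Defs.concave H -> (forall t, (0 <= t)%R -> 0 <= H t) -> (0 < e)%R ->
  H e < +oo ->
  exists a m : R, [/\ (0 <= a)%R, (0 <= m)%R,
    forall t, (0 <= t)%R -> H t <= (a + m * t)%:E & H e = (a + m * e)%:E].
Proof.
move=> cH H0 e0 Hoo.
have [h Hh] : exists h, H e = h%:E.
  by exists (fine (H e)); rewrite fineK// ge0_fin_numE// H0// ltW.
have slope s t u v : (0 <= s)%R -> (s < e)%R -> (e < t)%R -> u%:E <= H s ->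
    v%:E <= H t -> ((v - h) / (t - e) <= (h - u) / (e - s))%R.
  move=> s0 se et us vt.
  have st : (0 < t - s)%R by rewrite subr_gt0 (lt_trans se).
  (* The weight [k = (t - e) / (t - s)] solves [k * s + (1 - k) * t = e]. *)
  have k01 : (0 <= (t - e) / (t - s) <= 1)%R.
    rewrite divr_ge0 ?(ltW st) ?subr_ge0 ?(ltW et)//=.
    by rewrite ler_pdivrMr// mul1r lerB// ltW.
  have := concave_hypograph_conv cH s0 _ us vt k01.
  have -> : ((t - e) / (t - s) * s + (1 - (t - e) / (t - s)) * t)%R = e.
    by field; rewrite gt_eqF.
  rewrite Hh lee_fin => /(_ (ltW (le_lt_trans s0 (lt_trans se et)))) huv.
  rewrite ler_pdivrMr ?subr_gt0// mulrAC ler_pdivlMr ?subr_gt0//.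
  have {huv} : ((t - s) * ((t - e) / (t - s) * u + (1 - (t - e) / (t - s)) * v)
     <= (t - s) * h)%R by rewrite ler_pM2l.
  have -> : ((t - s) * ((t - e) / (t - s) * u + (1 - (t - e) / (t - s)) * v) =
      (t - e) * u + (e - s) * v)%R by field; rewrite gt_eqF.
  lra.
pose S := [set q : R | exists t v : R,
  [/\ (e < t)%R, v%:E <= H t & q = ((v - h) / (t - e))%R]].
have S0 : S ((0 - h) / (e + 1 - e))%R.
  by exists (e + 1)%R, 0%R; rewrite ltrDl ltr01 H0// addr_ge0// ltW.
have ubS s u : (0 <= s)%R -> (s < e)%R -> u%:E <= H s ->
    ubound S ((h - u) / (e - s))%R.
  by move=> s0 se us _ [t [v [et vt ->]]]; exact: slope.
have H00 : 0%:E <= H 0%R by exact: H0.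
have supS : has_sup S.
  by split; [eexists; exact: S0|eexists; exact: (ubS _ _ (lexx _) e0 H00)].
pose m := sup S.
(* Left of [e] this uses that [m] is at most every left quotient, right of [e] that [m] is at least
   every right quotient. *)
have below t v : (0 <= t)%R -> v%:E <= H t -> (v <= h + m * (t - e))%R.
  move=> t0 vt; have [te|et|te] := ltgtP t e.
  - have : (m <= (h - v) / (e - t))%R.
      by apply: ge_sup; [exact: (proj1 supS)|exact: ubS].
    rewrite ler_pdivlMr ?subr_gt0//; lra.
  - have : ((v - h) / (t - e) <= m)%R.
      by apply: ub_le_sup; [exact: (proj2 supS)|exists t, v].
    rewrite ler_pdivrMr ?subr_gt0//; lra.
  - by move: vt; rewrite te Hh lee_fin subrr mulr0 addr0.
have h0 : (0 <= h)%R by rewrite -lee_fin -Hh H0// ltW.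
exists (h - m * e)%R, m; split.
- by have := below _ _ (lexx _) H00; rewrite sub0r mulrN.
- rewrite leNgt; apply/negP => m0.
  (* For [m < 0] the line takes the value -1 at [e + (h + 1) / (- m)], where [H] is nonnegative. *)
  have q0 : (0 <= (h + 1) / (- m))%R.
    by rewrite divr_ge0 ?addr_ge0// oppr_ge0 ltW.
  have t0 : (0 <= e + (h + 1) / (- m))%R by rewrite addr_ge0// ltW.
  have := below _ _ t0 (H0 _ t0).
  have -> : (h + m * (e + (h + 1) / - m - e) = -1)%R by field; rewrite lt_eqF.
  lra.
- by move=> t t0; apply: le_of_EFin_le => v /(below _ _ t0); lra.
- by rewrite Hh; congr EFin; lra.
Qed.

(* Singletons need not be measurable, so a property of all pairs (x, zs i) is
   transferred to almost every pair through measurable neighbourhoods of zs i. *)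
Lemma measurable_prod_section_local {d1 d2 : measure_display}
    {T1 : measurableType d1} {T2 : measurableType d2} (B : set (T1 * T2))
    (y0 : T2) : measurable B ->
  exists A : set T2, [/\ measurable A, A y0 &
    forall x y, A y -> B (x, y) <-> B (x, y0)].
Proof.
(* The sets with this property form a sigma-algebra containing the preimages under both projections,
   and these generate the product sigma-algebra. *)
pose C : set_system (T1 * T2) := [set B | exists A : set T2,
  [/\ measurable A, A y0 & forall x y, A y -> B (x, y) <-> B (x, y0)]].
suff: (measurable : set_system (T1 * T2)) `<=` C by apply.
apply: smallest_sub.
  split.
  - by exists setT; split.
  - move=> D [A [mA Ay0 AD]]; exists A; split=> // x y Ay.
    by split=> -[_ nD]; split=> // /(AD x y Ay).
  - move=> F CF; have /choice[A AP] := CF.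
    exists (\bigcap_i A i); split.
    + by apply: bigcapT_measurable => i; have [] := AP i.
    + by move=> i _; have [] := AP i.
    + move=> x y Ay; split=> -[i _ Fi]; exists i => //.
        by have [_ _ /(_ x y (Ay i I))[+ _]] := AP i; apply.
      by have [_ _ /(_ x y (Ay i I))[_ +]] := AP i; apply.
move=> D [[A mA <-]|[A mA <-]].
  by exists setT; split.
have [Ay0|Ay0] := pselect (A y0).
  by exists A; split => // x y Ay; split => -[].
exists (~` A); split => //; first exact: measurableC.
by move=> x y Ay; split => -[].
Qed.

(** * Finitely supported probability measures *)

Section atomic.
Context {R : realType} {disp : measure_display} {T : measurableType disp}.
Context {I : finType}.
Implicit Types (P : probability T R) (w : I -> R) (x : I -> T).

(** Weights at coinciding points add up, so one atom may be split over several indices. *)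
Definition atomic P w x := forall A : set T, measurable A ->
  P A = \sum_i (w i)%:E * \d_(x i) A.

(** [msum] runs over measures indexed by natural numbers: [I] is enumerated, and indices from [#|I|]
    on receive the zero measure. *)
Let wsum w x (w0 : forall i, (0 <= w i)%R) : {measure set T -> \bar R} :=
  msum (fun k => if insub k is Some j
    then mscale (NngNum (w0 (enum_val (j : 'I_#|I|))))
           (\d_(x (enum_val j)) : {measure set T -> \bar R})
         : {measure set T -> \bar R}
    else mzero : {measure set T -> \bar R}) #|I|.

Let wsumE w x (w0 : forall i, (0 <= w i)%R) A :
  wsum w x w0 A = \sum_i (w i)%:E * \d_(x i) A.
Proof.
rewrite /wsum/= /msum/= [RHS]big_enum_val/=; apply: eq_bigr => k _.
by rewrite valK.
Qed.

Lemma atomic_exists w x : (forall i, (0 <= w i)%R) -> (\sum_i w i = 1)%R ->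
  exists P, atomic P w x.
Proof.
(* Normalization supplies the probability structure and divides by a total mass equal to 1;
   [dirac point] is only the default for zero or infinite mass. *)
move=> w0 w1; exists (mnormalize (wsum w x w0) (dirac point)) => A mA.
rewrite /= /mnormalize !wsumE.
have -> : \sum_i (w i)%:E * \d_(x i) [set: T] = 1.
  rewrite -[RHS]/(1%:E) -w1 -sumEFin; apply: eq_bigr => i _.
  by rewrite diracT mule1.
rewrite onee_eq0/= invr1 mule1; exact: wsumE.
Qed.

Variables (P : probability T R) (w : I -> R) (x : I -> T).
Hypothesis w0 : forall i, (0 <= w i)%R.
Hypothesis Pwx : atomic P w x.

Lemma atomic_weights_sum1 : (\sum_i w i = 1)%R.
Proof.
apply/EFin_inj; rewrite -(probability_setT P) Pwx// -sumEFin.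
by apply: eq_bigr => i _; rewrite diracT mule1.
Qed.

Lemma ge0_integral_atomic (f : T -> \bar R) : measurable_fun setT f ->
  (forall t, 0 <= f t) -> \int[P]_t f t = \sum_i (w i)%:E * f (x i).
Proof.
move=> mf f0.
rewrite (@eq_measure_integral _ _ _ _ (wsum w x w0))//; last first.
  by move=> A mA _; rewrite wsumE; exact: Pwx.
rewrite /wsum ge0_integral_measure_sum// [RHS]big_enum_val/=.
apply: eq_bigr => k _; rewrite valK ge0_integral_mscale//= integral_dirac//.
by rewrite diracT mul1e.
Qed.

Lemma expectation_atomic (X : T -> R) : measurable_fun setT X ->
  'E_P[X] = (\sum_i w i * X (x i))%:E.
Proof.
move=> mX; have mX' : measurable_fun setT (EFin \o X) by exact/measurable_EFinP.
rewrite unlock integralE !ge0_integral_atomic//; last 2 first.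
  exact: measurable_funeneg.
  exact: measurable_funepos.
have E (g : T -> R) : \sum_i (w i)%:E * (g (x i))%:E = (\sum_i w i * g (x i))%:E.
  by rewrite -sumEFin; apply: eq_bigr => i _; rewrite EFinM.
have -> : \sum_i (w i)%:E * (EFin \o X)^\+ (x i) =
    (\sum_i w i * (X ^\+)%R (x i))%:E.
  by rewrite -E; apply: eq_bigr => i _; rewrite funerpos.
have -> : \sum_i (w i)%:E * (EFin \o X)^\- (x i) =
    (\sum_i w i * (X ^\-)%R (x i))%:E.
  by rewrite -E; apply: eq_bigr => i _; rewrite funerneg.
rewrite -EFinB -sumrB; congr EFin; apply: eq_bigr => i _.
rewrite -mulrBr /funrpos /funrneg; congr (_ * _)%R.
have [X0|/ltW X0] := leP (X (x i)) 0%R.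
  by rewrite max_l ?oppr_ge0// sub0r opprK.
by rewrite max_r ?oppr_le0// subr0.
Qed.

Lemma atomic_integrable (X : T -> R) : measurable_fun setT X ->
  P.-integrable setT (EFin \o X).
Proof.
move=> mX; have mX' : measurable_fun setT (EFin \o X) by exact/measurable_EFinP.
apply/integrableP; split => //; rewrite ge0_integral_atomic//; last first.
  exact: measurableT_comp.
by apply: lte_sum_pinfty => i _; rewrite /= -EFinM ltry.
Qed.

Lemma atomic_ae (B : set T) : measurable B -> (forall i, B (x i)) ->
  {ae P, forall t, B t}.
Proof.
move=> mB Bx; exists (~` B); split; [exact: measurableC| |by []].
rewrite Pwx; last exact: measurableC.
rewrite big1// => i _; rewrite diracE memNset ?mule0//.
by apply; exact: Bx.
Qed.

End atomic.

(** The choices [k i] are independent, so all suprema can be approached at once; induction on [s]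
    frees one coordinate at a time. Having 0 in each [S i] keeps every supremum nonnegative. *)
Lemma sum_ereal_sup_le (R : realType) (I : eqType) (s : seq I) (m : I -> R)
    (S : I -> set R) (M : \bar R) :
  uniq s -> (forall i, (0 <= m i)%R) -> (forall i, S i 0%R) ->
  (forall k : I -> R, (forall i, S i (k i)) ->
     \sum_(i <- s) (m i)%:E * (k i)%:E <= M) ->
  \sum_(i <- s) (m i)%:E * ereal_sup (EFin @` S i) <= M.
Proof.
move=> + m0 S0; elim: s M => [M _ /(_ (fun=> 0%R) S0)|j s ih M /andP[js us] kM].
  by rewrite !big_nil.
rewrite big_cons; set T := \sum_(i <- s) _.
have sup_ge0 i : 0 <= ereal_sup (EFin @` S i).
  by apply: ereal_sup_ubound; exists 0%R.
have T0 : 0 <= T by apply: sume_ge0 => i _; rewrite mule_ge0// lee_fin.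
have TM x : S j x -> (m j)%:E * x%:E + T <= M.
  move=> Sx; rewrite addeC -leeBrDr//; apply: ih => // k Sk.
  rewrite leeBrDr// addeC.
  (* Overriding [k] at [j] leaves the tail unchanged because [j] does not occur in [s]. *)
  have := kM (fun i => if i == j then x else k i); rewrite big_cons eqxx.
  under eq_big_seq => i si.
    have -> : (i == j) = false by apply/eqP => ij; rewrite -ij si in js.
    over.
  by apply => i; case: eqP => // ->.
(* An infinite tail cannot be subtracted, but it already forces [M] to be [+oo]. *)
have [Too|Tfin] := eqVneq T +oo.
  by have := TM _ (S0 j); rewrite Too addey// leye_eq => /eqP ->; rewrite leey.
have Tf : T \is a fin_num by rewrite ge0_fin_numE// ltey.
rewrite -leeBrDr// -ereal_supZl//; last first.
  by apply/set0P; exists 0; exists 0%R.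
apply: ge_ereal_sup => _ [_ [x Sx <-] <-]; rewrite leeBrDr//; exact: TM.
Qed.

(** * Star-shaped majorants and partial transport *)

Section star.
Context {R : realType} {disp : measure_display} {Z : measurableType disp}.
Variables (d : Z -> Z -> \bar R) (X : Z -> R).
Hypothesis d_ge0 : forall z' z, 0 <= d z' z.

(* Gains obtained by moving only a fraction [eta] of the mass at [z] to a point
   [z'], at total cost at most [t]. *)
Definition partial_gains (r : R) (z : Z) (t : R) : set R :=
  [set q | exists (eta : R) (z' : Z), [/\ (0 <= eta <= 1)%R,
    eta%:E * d z' z `^ r <= t%:E & q = (eta * (X z' - X z))%R]].

Lemma partial_gains0 r z t : (0 <= t)%R -> partial_gains r z t 0%R.
Proof.
move=> t0; exists 0%R, z; rewrite lexx ler01; split => //.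
  by rewrite mul0e lee_fin.
by rewrite mul0r.
Qed.

Lemma poweR_le_cost (r : R) z' z (t : R) : (0 < r)%R -> (0 <= t)%R ->
  d z' z <= (t `^ r^-1)%:E -> d z' z `^ r <= t%:E.
Proof.
move=> r0 t0 dt.
have -> : t%:E = (t `^ r^-1)%:E `^ r.
  by rewrite poweR_EFin -powRrM mulVf ?gt_eqF// powRr1.
apply: gt0_ler_poweR => //; first exact: ltW.
  by rewrite in_itv/= d_ge0 leey.
by rewrite in_itv/= leey andbT lee_fin powR_ge0.
Qed.

(** The right-hand side is itself a star-shaped majorant in the variable [t]: full moves ([eta = 1])
    give majorization, and shrinking the moved fraction shrinks cost and gain by the same factor. *)
Lemma least_star_majorant_le (r : R) z (t : R) : (0 < r)%R -> (0 <= t)%R ->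
  least_star_majorant (fun t => rate d X z (t `^ r^-1)%R) t <=
  ereal_sup (EFin @` partial_gains r z t).
Proof.
move=> r0 t0; pose K t := ereal_sup (EFin @` partial_gains r z t).
have K0 u : (0 <= u)%R -> 0 <= K u.
  by move=> u0; apply: ereal_sup_ubound; exists 0%R => //; exact: partial_gains0.
apply: ereal_inf_lbound; exists K => //; split; last split.
- move=> u u0; apply: ge_ereal_sup => _ [z' /= dz' <-].
  apply: ereal_sup_ubound; exists (X z' - X z)%R => //.
  exists 1%R, z'; rewrite ler01 lexx mul1e mul1r; split => //.
  exact: poweR_le_cost.
- exact: K0.
- move=> [u y] eta [/= u0 yK] /andP[eta0 eta1].
  have v0 : (0 <= eta * u)%R by rewrite mulr_ge0.
  split; first exact: v0.
  rewrite /= EFinM; apply: (@le_trans _ _ (eta%:E * K u)).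
    by rewrite lee_wpmul2l // lee_fin.
  rewrite -ereal_supZl//; last first.
    by apply/set0P; exists 0; exists 0%R => //; exact: partial_gains0.
  apply: ge_ereal_sup => _ [_ [_ [k [z' [/andP[k0 k1] kd ->]]] <-] <-].
  apply: ereal_sup_ubound; exists (eta * (k * (X z' - X z)))%R; last by rewrite EFinM.
  exists (eta * k)%R, z'; split.
  + by rewrite mulr_ge0//= mulr_ile1.
  + by rewrite !EFinM -muleA lee_wpmul2l // lee_fin.
  + by rewrite mulrA.
Qed.
End star.

(** * Comparing expectations through a coupling *)

Section coupling_bound.
Context {R : realType} {disp : measure_display} {Z : measurableType disp}.
Context {P Q : probability Z R} {gam : probability (Z * Z)%type R}.
Hypothesis cpl : coupling P Q gam.

Lemma ge0_integral_coupling_fst (f : Z -> \bar R) : measurable_fun setT f ->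
  (forall z, 0 <= f z) -> \int[gam]_z f z.1 = \int[P]_z f z.
Proof.
move=> mf f0.
have mfst : measurable_fun [set: (Z * Z)%type] (@fst Z Z) by exact: measurable_fst.
rewrite (@eq_measure_integral _ _ _ setT (pushforward gam fst))//; last first.
  move=> A mA _; rewrite -[LHS](proj1 cpl _ mA) /= /pushforward; congr (gam _).
  by apply/seteqP; split => [[x y] []|[x y] Axy].

by rewrite ge0_integral_pushforward.
Qed.

Lemma ge0_integral_coupling_snd (f : Z -> \bar R) : measurable_fun setT f ->
  (forall z, 0 <= f z) -> \int[gam]_z f z.2 = \int[Q]_z f z.
Proof.
move=> mf f0.
have msnd : measurable_fun [set: (Z * Z)%type] (@snd Z Z) by exact: measurable_snd.
rewrite (@eq_measure_integral _ _ _ setT (pushforward gam snd))//; last first.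
  move=> A mA _; rewrite -[LHS](proj2 cpl _ mA) /= /pushforward; congr (gam _).
  by apply/seteqP; split => [[x y] []|[x y] Axy].

by rewrite ge0_integral_pushforward.
Qed.

(** Both expectations are integrals over the product space against [gam], where the
    almost-everywhere inequality can be integrated. *)
Lemma expectation_sub_le_coupling (X : Z -> R) (G : Z * Z -> \bar R) :
  measurable_fun setT X -> Q.-integrable setT (EFin \o X) ->
  measurable_fun setT G -> (forall z, 0 <= G z) ->
  {ae gam, forall z, (X z.1)%:E <= (X z.2)%:E + G z} ->
  'E_P[X] - 'E_Q[X] <= \int[gam]_z G z.
Proof.
move=> mX iX mG G0 XG.
have mX' : measurable_fun setT (EFin \o X) by exact/measurable_EFinP.
have EQfin : 'E_Q[X] \is a fin_num by rewrite unlock; exact: integrable_fin_num.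
have [->|/eqP Goo] := eqVneq (\int[gam]_z G z) +oo; first by rewrite leey.
have iG : gam.-integrable setT G.
  apply/integrableP; split => //; under eq_integral do rewrite gee0_abs//.
  by rewrite ltey; exact/eqP.
pose f := EFin \o X \o (@fst Z Z); pose h := EFin \o X \o (@snd Z Z).
have mf : measurable_fun setT f by exact: measurableT_comp.
have mh : measurable_fun setT h by exact: measurableT_comp.
have fE : \int[gam]_z f z = 'E_P[X].
  rewrite unlock integralE [RHS]integralE; congr (_ - _).
    rewrite -ge0_integral_coupling_fst//; last exact: measurable_funepos.
    by apply: eq_integral => z _; rewrite !unlock.
  rewrite -ge0_integral_coupling_fst//; last exact: measurable_funeneg.
    by apply: eq_integral => z _; rewrite !unlock.
have hE : \int[gam]_z h z = 'E_Q[X].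
  rewrite unlock integralE [RHS]integralE; congr (_ - _).
    rewrite -ge0_integral_coupling_snd//; last exact: measurable_funepos.
    by apply: eq_integral => z _; rewrite !unlock.
  rewrite -ge0_integral_coupling_snd//; last exact: measurable_funeneg.
    by apply: eq_integral => z _; rewrite !unlock.
have ih : gam.-integrable setT h.
  apply/integrableP; split => //.
  have /integrableP[_] := iX.
  rewrite -(ge0_integral_coupling_snd (abse \o (EFin \o X)))//.
    exact: measurableT_comp.
  by move=> z; exact: abse_ge0.
rewrite leeBlDl// -hE -fE -integralD//.
(* [X] is only known to be integrable under [Q], so the comparison is made separately on positive
   and negative parts. *)
rewrite [leLHS]integralE [leRHS]integralE; apply: leeB; apply: ae_ge0_le_integral => //.
- exact: measurable_funepos.
- by apply: measurable_funepos; exact: emeasurable_funD.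
- by apply: filterS XG => z XGz _; rewrite !unlock le_max2.
- by apply: measurable_funeneg; exact: emeasurable_funD.
- exact: measurable_funeneg.
- by apply: filterS XG => z XGz _; rewrite !unlock le_max2// leeN2.
Qed.
End coupling_bound.

(** * Transport to and from a finitely supported reference measure *)

Section transport_bounds.
Context {R : realType} {disp : measure_display} {Z : measurableType disp}.
Context {d : Z -> Z -> \bar R} {X : Z -> R}.
Hypothesis d_meas : measurable_fun [set: (Z * Z)%type] (fun zz => d zz.1 zz.2).
Hypothesis d_diag : forall z : Z, d z z = 0.
Hypothesis X_meas : measurable_fun setT X.
Context {N : nat} {zs : 'I_N -> Z} {mu : 'I_N -> R} {PN : probability Z R}.
Hypothesis mu_ge0 : forall i : 'I_N, (0 <= mu i)%R.
Hypothesis PNE : atomic PN mu zs.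

Lemma measurable_cost (r : R) :
  measurable_fun [set: (Z * Z)%type] (fun zz => d zz.1 zz.2 `^ r).
Proof. by apply: (measurableT_comp (measurable_poweR r)). Qed.

Lemma mass_transport_le_dr_risk (p : \bar R) (eps : R) (eta : 'I_N -> R)
    (z' : 'I_N -> Z) : 1 <= p -> (0 < eps)%R ->
  (forall i, (0 <= eta i <= 1)%R) ->
  match p with
  | r%:E => forall i, (eta i)%:E * d (z' i) (zs i) `^ r <= (eps `^ r)%:E
  | +oo => forall i, d (z' i) (zs i) <= eps%:E
  | -oo => True
  end ->
  \sum_(i < N) (mu i)%:E * (eta i * (X (z' i) - X (zs i)))%:E <=
    dr_risk d p PN X eps - 'E_PN[X].
Proof.
move=> p1 eps0 eta01 cost.
(* Index [(i, true)] carries the moved part of atom [i] and [(i, false)] the part left in place; [y]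
   pairs the new position with the old one, which yields a coupling. *)
pose w (k : 'I_N * bool) := (mu k.1 * (if k.2 then eta k.1 else 1 - eta k.1))%R.
pose x (k : 'I_N * bool) := if k.2 then z' k.1 else zs k.1.
pose y (k : 'I_N * bool) := (x k, zs k.1).
have w0 k : (0 <= w k)%R.
  case: k => i [] /=; rewrite mulr_ge0//=; have /andP[] := eta01 i => //.
  by rewrite subr_ge0.
have sumE (F : 'I_N * bool -> \bar R) :
    \sum_k F k = \sum_(i < N) (F (i, true) + F (i, false)).
  rewrite [LHS](eq_bigr (fun k => F (k.1, k.2))); last by case.
  rewrite -(pair_bigA _ (fun i b => F (i, b)))/=.
  by apply: eq_bigr => i _; rewrite big_bool.
have mu1 := atomic_weights_sum1 _ _ _ PNE.
have w1 : (\sum_k w k = 1)%R.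
  apply: EFin_inj; rewrite -sumEFin sumE -mu1 -sumEFin.
  by apply: eq_bigr => i _; rewrite -EFinD -mulrDr addrC subrK mulr1.
have [P Px] := atomic_exists w x w0 w1.
have [gam gamy] := atomic_exists w y w0 w1.
have cpl : coupling P PN gam.
  split=> A mA.
    rewrite gamy; last exact: measurableX.
    rewrite Px//; apply: eq_bigr => k _; congr (_ * _).
    by rewrite !diracE in_setX [_ \in setT]mem_setT andbT.
  rewrite gamy; last exact: measurableX.
  rewrite PNE// sumE; apply: eq_bigr => i _.
  rewrite !diracE !in_setX !mem_setT/= -ge0_muleDl ?lee_fin ?w0//.
  by rewrite -EFinD -mulrDr addrC subrK mulr1.
have iX := atomic_integrable P w x w0 Px X X_meas.
have EP : 'E_P[X] - 'E_PN[X] =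
    \sum_(i < N) (mu i)%:E * (eta i * (X (z' i) - X (zs i)))%:E.
  rewrite (expectation_atomic P w x)// (expectation_atomic PN mu zs)//.
  rewrite -sumEFin sumE -EFinN -sumrN -sumEFin -big_split/=.
  by apply: eq_bigr => i _; rewrite -!EFinD -EFinM; congr EFin; rewrite /w/=; ring.
rewrite -EP leeB//; apply: ereal_sup_ubound; exists P => //; split; last first.
  by left; apply: integral_funepos_lt_pinfty.
case: p p1 cost => [r|_|//] /=.
  rewrite lee_fin => r1 cost.
  have r0 : (0 < r)%R := lt_le_trans ltr01 r1.
  (* The root is monotone, so feasibility reduces to bounding the cost of [gam] by the [r]-th power
     of [eps]. *)
  have -> : eps%:E = (eps `^ r)%:E `^ r^-1.
    by rewrite poweR_EFin -powRrM mulfV ?gt_eqF// powRr1// ltW.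
  have erpos : (0 <= eps `^ r)%R by rewrite powR_ge0.
  have inf0 : 0 <= ereal_inf [set \int[pi]_z (d z.1 z.2 `^ r) | pi in coupling P PN].
    by apply: le_ereal_inf_tmp => _ [g _ <-];
      apply: integral_ge0 => *; exact: poweR_ge0.
  apply: gt0_ler_poweR.
  - by rewrite invr_ge0 ltW.
  - by rewrite in_itv/= inf0 leey.
  - by rewrite in_itv/= leey andbT lee_fin.
  apply: ge_ereal_inf; exists (\int[gam]_z (d z.1 z.2 `^ r)); first by exists gam.
  rewrite (ge0_integral_atomic gam w y)//; last 2 first.
    exact: measurable_cost.
    by move=> z; exact: poweR_ge0.
  rewrite sumE /w/y/x/=.
  have -> : (eps `^ r)%:E = \sum_(i < N) (mu i)%:E * (eps `^ r)%:E.
    rewrite -ge0_sume_distrl; last by move=> i _; rewrite lee_fin.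
    by rewrite sumEFin mu1 mul1e.
  apply: lee_sum => i _; rewrite d_diag poweR0r ?gt_eqF// mule0 adde0.
  by rewrite EFinM -muleA lee_wpmul2l// lee_fin.
move=> cost; apply: ge_ereal_inf; exists (ess_sup gam (fun z => d z.1 z.2)).
  by exists gam.
apply/ess_supP; apply: (atomic_ae gam w y gamy [set z | d z.1 z.2 <= eps%:E]).
  rewrite -[X in measurable X]setTI; apply: emeasurable_fun_infty_c => //.
by move=> [i []] /=; rewrite /y/x/=// d_diag lee_fin ltW.
Qed.

(** The neighbourhoods on which [B] transfers from the points [zs i] cover a set of full [PN]-mass,
    so the strip over its complement is null for [gam]. *)
Lemma coupling_atomic_ae (P : probability Z R) (gam : probability (Z * Z)%type R)
    (B : set (Z * Z)) : coupling P PN gam -> measurable B ->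
  (forall z i, B (z, zs i)) -> {ae gam, forall z, B z}.
Proof.
move=> cpl mB Bzs.
have /choice[A AP] i := measurable_prod_section_local B (zs i) mB.
pose U := \bigcup_i A i.
have mU : measurable U.
  by apply: fin_bigcup_measurable => // i _; have [] := AP i.
exists (setT `*` ~` U); split.
- by apply: measurableX => //; exact: measurableC.
- rewrite (proj2 cpl); last exact: measurableC.
  rewrite PNE; last exact: measurableC.
  rewrite big1// => i _; rewrite diracE memNset ?mule0//.
  by apply; exists i => //; have [] := AP i.
- move=> [z' z] /= nB; split => // -[i _ Az]; apply: nB.
  by have [_ _ /(_ z' z Az)[_ +]] := AP i; apply.
Qed.

Lemma rate_ge z i (t : R) : d z (zs i) <= t%:E ->
  (X z - X (zs i))%:E <= rate d X (zs i) t.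
Proof. by move=> dz; apply: ereal_sup_ubound; exists z. Qed.

Lemma rate_ge0 z (t : R) : (0 <= t)%R -> 0 <= rate d X z t.
Proof.
move=> t0; apply: ereal_sup_ubound; exists z; last by rewrite subrr.
by rewrite /= d_diag lee_fin.
Qed.

Lemma le_rate z (s t : R) : (s <= t)%R -> rate d X z s <= rate d X z t.
Proof.
move=> st; apply: le_ereal_sup => _ [z' dz <-]; exists z' => //=.
by rewrite (le_trans dz)// lee_fin.
Qed.

Let iX : PN.-integrable setT (EFin \o X).
Proof. exact: (atomic_integrable PN mu zs). Qed.

(** The infimum of the costs need not be attained, so a bound affine in the cost is proved for every
    coupling of finite cost and then applied to nearly optimal ones. *)
Lemma expectation_sub_le_concave (r e : R) (H : R -> \bar R)
    (P : probability Z R) : (forall z' z, 0 <= d z' z) -> (1 <= r)%R -> (0 < e)%R ->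
  Defs.concave H -> majorizes H (fun t => max_rate d X zs (t `^ r^-1)) ->
  ereal_inf [set \int[gam]_z (d z.1 z.2 `^ r) | gam in coupling P PN] <= e%:E ->
  'E_P[X] - 'E_PN[X] <= H e.
Proof.
move=> d_ge0 r1 e0 cH majH infe.
have r0 : (0 < r)%R := lt_le_trans ltr01 r1.
have rateH i t : (0 <= t)%R -> rate d X (zs i) (t `^ r^-1)%R <= H t.
  move=> t0; apply: le_trans (majH _ t0).
  exact: (le_bigmax _ (fun i => rate d X (zs i) (t `^ r^-1)%R)).
(* An index exists because the weights sum to 1; [H] is then nonnegative, as it dominates the rate
   at that atom. *)
have [i0] : exists i0 : 'I_N, True.
  have [i _|I0] := pickP 'I_N; first by exists i.
  have := atomic_weights_sum1 _ _ _ PNE; rewrite big_pred0//.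
  by move/esym/eqP; rewrite oner_eq0.
move=> _.
have H0 t : (0 <= t)%R -> 0 <= H t.
  by move=> t0; apply: le_trans (rateH i0 _ t0); rewrite rate_ge0// powR_ge0.
have [->|/eqP Hoo] := eqVneq (H e) +oo; first by rewrite leey.
have [|a [m [a0 m0 Hle ->]]] := concave_supporting_line _ H e cH H0 e0.
  by rewrite ltey; exact/eqP.
suff bnd (gam : probability (Z * Z)%type R) : coupling P PN gam ->
    \int[gam]_z (d z.1 z.2 `^ r) < +oo ->
    'E_P[X] - 'E_PN[X] <= a%:E + m%:E * \int[gam]_z (d z.1 z.2 `^ r).
  apply/lee_addgt0Pr => dl dl0.
  (* The slack [dl / (m + 1)] in the cost contributes at most [dl] after multiplication by [m],
     including when [m = 0]. *)
  have m1 : (0 < m + 1)%R by rewrite ltr_wpDl.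
  have [_ [gam cpl <-] lt] : exists2 y,
      [set \int[gam]_z (d z.1 z.2 `^ r) | gam in coupling P PN] y &
      y < (e + dl / (m + 1))%:E.
    by apply/ereal_inf_lt; rewrite (le_lt_trans infe)// lte_fin ltrDl divr_gt0.
  apply: (le_trans (bnd _ cpl (lt_trans lt (ltry _)))).
  apply: (@le_trans _ _ (a%:E + m%:E * (e + dl / (m + 1))%:E)).
    by rewrite leeD2l// lee_wpmul2l ?lee_fin// ltW.
  rewrite -EFinM -!EFinD lee_fin mulrDr addrA lerD2l mulrCA ger_pMr//.
  by rewrite ler_pdivrMr// mul1r lerDl.
move=> cpl doo; pose G (z : Z * Z) := a%:E + m%:E * d z.1 z.2 `^ r.
have mdr := measurable_cost r.
have G0 z : 0 <= G z by rewrite adde_ge0 ?mule_ge0 ?lee_fin ?poweR_ge0.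
have mG : measurable_fun setT G.
  by apply: emeasurable_funD => //; exact: measurable_funeM.
have -> : a%:E + m%:E * \int[gam]_z (d z.1 z.2 `^ r) = \int[gam]_z G z.
  rewrite ge0_integralD//; last 2 first.
    by move=> z _; rewrite mule_ge0 ?lee_fin ?poweR_ge0.
    exact: measurable_funeM.
  have gam1 : gam setT = 1 := probability_setT gam.
  rewrite integral_cst// [X in a%:E * X](_ : _ = 1)// mule1 ge0_integralZl//.
  by move=> z _; exact: poweR_ge0.
apply: (expectation_sub_le_coupling cpl) => //.
(* Pairs at infinite cost are set apart, since for [m = 0] the convention [0 * +oo = 0] leaves [G]
   finite there. They form a null set because the cost is integrable. *)
pose B := [set z : Z * Z | (X z.1)%:E <= (X z.2)%:E + G z] `|`
  [set z | +oo <= d z.1 z.2 `^ r].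
have mB : measurable B.
  apply: measurableU; last first.
    by rewrite -[X in measurable X]setTI; exact: emeasurable_fun_c_infty.
  rewrite -[X in measurable X]setTI; apply: measurable_lee => //.
    by apply/measurable_EFinP; exact: measurableT_comp.
  apply: emeasurable_funD => //.
  by apply/measurable_EFinP; exact: measurableT_comp.
have Bzs z i : B (z, zs i).
  rewrite /B/G/=; case: (d z (zs i)) (d_ge0 z (zs i)) (rate_ge z i) => [c||]//=.
    rewrite lee_fin => c0 /(_ c (lexx _)) Xc; left.
    rewrite -leeBlDl// -EFinD (le_trans Xc)//.
    apply: le_trans (Hle _ (powR_ge0 _ _)).
    apply: le_trans (rateH i _ (powR_ge0 _ _)).
    by rewrite -powRrM mulfV ?gt_eqF// powRr1.
  by right; rewrite gt_eqF.
have idr : gam.-integrable setT (fun z : Z * Z => d z.1 z.2 `^ r).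
  apply/integrableP; split => //.
  by under eq_integral do rewrite gee0_abs ?poweR_ge0//.
have dfin := integrable_ae measurableT idr.
apply: filterS2 dfin (coupling_atomic_ae _ _ _ cpl mB Bzs) => z /(_ I) dz [//|/=].
by rewrite leye_eq => /eqP dzoo; rewrite dzoo in dz.
Qed.

(** As a function of the base point the rate need not be measurable, so it is replaced by a
    measurable function [g] of the second coordinate, bounded at each atom by the rate there. *)
Lemma expectation_sub_le_ess (P : probability Z R)
    (gam : probability (Z * Z)%type R) (t : R) : (0 <= t)%R ->
  coupling P PN gam -> {ae gam, forall z, d z.1 z.2 <= t%:E} ->
  'E_P[X] - 'E_PN[X] <= \sum_(i < N) (mu i)%:E * rate d X (zs i) t.
Proof.
move=> t0 cpl dt.
pose B i := [set z : Z * Z | (X z.1)%:E <= (X z.2)%:E + rate d X (zs i) t] `|`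
  ~` [set z | d z.1 z.2 <= t%:E].
have mB i : measurable (B i).
  apply: measurableU; last first.
    apply: measurableC.
    by rewrite -[X in measurable X]setTI; exact: emeasurable_fun_infty_c.
  rewrite -[X in measurable X]setTI; apply: measurable_lee => //.
    by apply/measurable_EFinP; exact: measurableT_comp.
  apply: emeasurable_funD => //.
  by apply/measurable_EFinP; exact: measurableT_comp.
have Bzs i z : B i (z, zs i).
  have [dz|ndz] := pselect (d z (zs i) <= t%:E); [left|by right].
  by rewrite /= -leeBlDl// -EFinD rate_ge.
have /choice[A AP] i := measurable_prod_section_local (B i) (zs i) (mB i).
have mA i : measurable (A i) by have [] := AP i.
have Azs i : A i (zs i) by have [] := AP i.
have AB i z' z : A i z -> B i (z', z).
  by have [_ _ AiP] := AP i; move=> /(AiP z')[_]; apply; exact: Bzs.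
(* The sets [A i] may overlap, and the minimum keeps [g (zs i)] below the i-th
   rate. *)
pose g (z : Z) := \big[mine/+oo]_(i < N)
  (if z \in A i then rate d X (zs i) t else +oo).
have g0 z : 0 <= g z.
  rewrite /g; elim/big_ind : _ => // [x y x0 y0|i _].
    by rewrite le_min x0.
  by case: ifP => // _; exact: rate_ge0.
have mg : measurable_fun setT g.
  rewrite /g; elim: (index_enum _) => [|i s ih].
    by under eq_fun do rewrite big_nil; exact: measurable_cst.
  under eq_fun do rewrite big_cons; apply: measurable_mine => //.
  apply: measurable_fun_ifT => //; apply: (measurable_fun_bool true).
  rewrite [X in measurable X](_ : _ = A i)//; apply/seteqP.
  by split => z /=; [case=> _ /set_mem|move=> Az; split => //; exact: mem_set].
have gzs i : g (zs i) <= rate d X (zs i) t.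
  apply: (@le_trans _ _ (if zs i \in A i then rate d X (zs i) t else +oo)).
    exact: bigmin_le.
  by rewrite mem_set.
apply: (@le_trans _ _ (\int[gam]_z g z.2)); last first.
  rewrite (ge0_integral_coupling_snd cpl)// (ge0_integral_atomic PN mu zs)//.
  by apply: lee_sum => i _; rewrite lee_wpmul2l// lee_fin.
apply: (expectation_sub_le_coupling cpl) => //; first exact: measurableT_comp.
apply: filterS dt => -[z' z]/= dz.
(* The inequality holds with each single term of the minimum, trivially when that term is [+oo],
   hence with the minimum. *)
rewrite /g; elim/big_ind : _ => // [|u v|i _].
- by rewrite addey// leey.
- by rewrite /mine; case: ifP.
- case: ifPn => [/set_mem/(AB i z')[//|/(_ dz)//]|_].
  by rewrite addey// leey.
Qed.

End transport_bounds.

(** * Assembling the two bounds *)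

Lemma wasserstein_le_cost (R : realType) (disp : measure_display)
    (Z : measurableType disp) (d : Z -> Z -> \bar R) (P Q : probability Z R)
    (r eps : R) : (0 < r)%R ->
  wasserstein d r%:E P Q <= eps%:E ->
  ereal_inf [set \int[gam]_z (d z.1 z.2 `^ r) | gam in coupling P Q] <=
    (eps `^ r)%:E.
Proof.
move=> r0 /=; set I := ereal_inf _ => Ieps.
have I0 : 0 <= I.
  by apply: le_ereal_inf_tmp => _ [g _ <-];
    apply: integral_ge0 => *; exact: poweR_ge0.
have -> : I = (I `^ r^-1) `^ r by rewrite -poweRrM mulVf ?gt_eqF// poweRe1.
rewrite -poweR_EFin; apply: gt0_ler_poweR => //; first exact: ltW.
  by rewrite in_itv/= poweR_ge0 leey.
by rewrite in_itv/= leey andbT (le_trans (poweR_ge0 _ _) Ieps).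
Qed.

(** Monotonicity in the radius makes the [lim] in [upper_bound] a genuine right limit rather than a
    default value. *)
Lemma cvg_rate_at_right (R : realType) (disp : measure_display)
    (Z : measurableType disp) (d : Z -> Z -> \bar R) (X : Z -> R) (z : Z)
    (eps : R) : cvg (rate d X z t @[t --> eps^'+]).
Proof.
apply: (cvgP (ereal_inf (rate d X z @` `]eps, +oo[))).
by apply: nondecreasing_at_right_cvge => // s t _ _; exact: le_rate.
Qed.

Theorem theorem1 (R : realType) (disp : measure_display)
    (Z : measurableType disp) (Theta : Type)
    (d : Z -> Z -> \bar R)
    (d_ge0 : forall z' z : Z, 0 <= d z' z)
    (d_meas : measurable_fun [set: (Z * Z)%type] (fun zz => d zz.1 zz.2))
    (d_diag : forall z : Z, d z z = 0)
    (l : Z -> Theta -> R) (theta : Theta)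
    (l_meas : measurable_fun [set: Z] (fun z => l z theta))
    (N : nat) (zs : 'I_N -> Z) (mu : 'I_N -> R)
    (mu_ge0 : forall i : 'I_N, (0 <= mu i)%R)
    (PN : probability Z R)
    (PNE : forall A : set Z, measurable A ->
       PN A = \sum_(i < N) (mu i)%:E * \d_(zs i) A)
    (p : \bar R) (p_ge1 : 1 <= p)
    (eps : R) (eps_gt0 : (0 < eps)%R) :
  let X := fun z => l z theta in
  lower_bound d X p mu zs eps <= dr_risk d p PN X eps - 'E_PN[X] /\
  dr_risk d p PN X eps - 'E_PN[X] <= upper_bound d X p mu zs eps.
Proof.
move=> X.
have EPN : 'E_PN[X] \is a fin_num by rewrite (expectation_atomic PN mu zs).
split.
- case: p p_ge1 => [r| |//] p1; rewrite /lower_bound/=.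
    have r0 : (0 < r)%R by rewrite (lt_le_trans ltr01)// -lee_fin.
    apply: (@le_trans _ _ (\sum_(i < N) (mu i)%:E *
        ereal_sup (EFin @` partial_gains d X r (zs i) (eps `^ r)))).
      apply: lee_sum => i _; rewrite lee_wpmul2l ?lee_fin//.
      exact: (least_star_majorant_le _ _ d_ge0 _ _ _ r0 (powR_ge0 _ _)).
    apply: sum_ereal_sup_le => //; first exact: index_enum_uniq.
      by move=> i; apply: partial_gains0; exact: powR_ge0.
    move=> k /choice[eta /choice[z' ez]].
    under eq_bigr => i _ do have [_ _ ->] := ez i.
    apply: mass_transport_le_dr_risk => // [i|i]; by have [] := ez i.
  (* For [p = +oo] whole atoms are moved, so all fractions are 1. *)
  pose S i := [set (X z' - X (zs i))%R | z' in [set z' | d z' (zs i) <= eps%:E]].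
  have rateS i : rate d X (zs i) eps = ereal_sup (EFin @` S i).
    by rewrite /rate/S image_comp.
  under eq_bigr do rewrite rateS.
  apply: sum_ereal_sup_le => //; first exact: index_enum_uniq.
    by move=> i; exists (zs i); rewrite /= ?subrr// d_diag lee_fin ltW.
  move=> k kS.
  have /choice[z' z'P] i : exists z', d z' (zs i) <= eps%:E /\
      k i = (1 * (X z' - X (zs i)))%R.
    by have [z' dz' <-] := kS i; exists z'; rewrite mul1r.
  under eq_bigr do rewrite (proj2 (z'P _)).
  apply: (mass_transport_le_dr_risk d_meas d_diag l_meas mu_ge0 PNE _ _
    (fun=> 1%R)) => //.
  - by move=> i; rewrite ler01 lexx.
  - by move=> i; have [] := z'P i.
- rewrite leeBlDr//; apply: ge_ereal_sup => _ [P [WP _] <-].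
  rewrite -leeBlDr//; case: p p_ge1 WP => [r| |//] p1 WP; rewrite /upper_bound.
    rewrite lee_fin in p1.
    apply: le_ereal_inf_tmp => _ [H [majH cH] <-].
    apply: (expectation_sub_le_concave d_meas d_diag l_meas mu_ge0 PNE r) => //.
      exact: powR_gt0.
    by apply: wasserstein_le_cost => //; exact: lt_le_trans p1.
  (* A coupling with essential supremum below [t] is available for every [t > eps], though perhaps
     none with essential supremum at most [eps]; the bound at radius [t] is therefore passed to the
     right limit. *)
  have cvgS : \sum_(i < N) (mu i)%:E * rate d X (zs i) t @[t --> eps^'+] -->
      \sum_(i < N) (mu i)%:E * lim (rate d X (zs i) t @[t --> eps^'+]).
    apply: cvg_nnesum => i _; last by apply: cvgeZl => //; exact: cvg_rate_at_right.
    near=> t; rewrite mule_ge0 ?lee_fin// rate_ge0//.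
    by rewrite ltW// (lt_trans eps_gt0).
  apply: cvge_ge cvgS; near=> t.
  have et : (eps < t)%R by [].
  have [_ [gam cpl <-] lt] : exists2 y,
      [set ess_sup gam (fun z => d z.1 z.2) | gam in coupling P PN] y & y < t%:E.
    by apply/ereal_inf_lt; rewrite (le_lt_trans WP)// lte_fin.
  apply: (expectation_sub_le_ess d_meas d_diag l_meas mu_ge0 PNE _ gam) => //.
    by rewrite ltW// (lt_trans eps_gt0).
  exact/ess_supP/ltW.
Unshelve. all: by end_near. Qed.
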